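(* Let $\Omega \subseteq \mathbb{C}$ be a bounded domain and let $J \subseteq \partial\Omega$ be a compact set without isolated points. Let $$ S(\Omega, J) = \Big\{ f \in R(\Omega) : \limsup_{\substack{z \to z_0 \\ z \in J \setminus \{z_0\}}} \Big| \frac{f(z) - f(z_0)}{z - z_0} \Big| = +\infty \ \text{ for every } z_0 \in J \Big\}. $$ Then $S(\Omega, J)$ is either empty or a dense $G_\delta$ subset of $R(\Omega)$.
   Context: A domain is a nonempty connected open subset of $\mathbb{C}$. For a bounded domain $\Omega \subseteq \mathbb{C}$, $R(\Omega)$ denotes the set of all functions $f : \overline{\Omega} \to \mathbb{C}$ that are uniform limits on $\overline{\Omega}$ of rational functions with poles off $\overline{\Omega}$ (i.e. all poles lie outside $\overline{\Omega}$). It is endowed with the supremum norm on $\overline{\Omega}$, which makes it a Banach space; ''dense'' and ''$G_\delta$'' refer to the topology of this norm. *)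

(* Defs.v *)
From HB Require Import structures.
From mathcomp Require Import all_boot all_order all_algebra.
From mathcomp Require Import all_classical all_reals all_analysis.
From mathcomp Require Import complex.

Set Implicit Arguments.
Unset Strict Implicit.
Unset Printing Implicit Defensive.

Import Order.TTheory GRing.Theory Num.Theory.
Import numFieldNormedType.Exports.

Local Open Scope classical_set_scope.
Local Open Scope ring_scope.
Local Open Scope complex_scope.

(* [R[i]^o] is [R[i]] seen as a normed space over itself; this is where the
   library puts the topology of the complex plane. Its norm `|z| is the modulus
   as an element of [R[i]]; [Normc.normc z] is the modulus as an element of [R]. *)

Record boundedDomain (R : realType) := BoundedDomain {
  domain_set :> set R[i]^o;
  domain_neq0 : domain_set !=set0;
  domain_open : open domain_set;
  domain_connected : connected domain_set;
  domain_bounded : bounded_set domain_set }.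

Definition boundary {T : topologicalType} (A : set T) : set T :=
  closure A `\` interior A.

(* Rational functions p / q; the poles are off [K] when q vanishes nowhere on K. *)
Definition rational_off_poles (R : realType) (K : set R[i]^o)
    (r : K -> R[i]^o) : Prop :=
  exists p q : {poly R[i]},
    (forall z : K, q.[\val z] != 0) /\ (forall z : K, r z = p.[\val z] / q.[\val z]).

Definition uniform_rational_limit (R : realType) (K : set R[i]^o)
    (f : K -> R[i]^o) : Prop :=
  exists r : nat -> K -> R[i]^o,
    (forall n, rational_off_poles (r n)) /\ {uniform, r @ \oo --> f}.

Definition RO_pred (R : realType) (Omega : boundedDomain R) :
    {pred closure Omega -> R[i]^o} :=
  fun f => `[< uniform_rational_limit f >].
Arguments RO_pred {R} Omega _.

(* The space written R(Omega) in the literature. *)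
Record RO (R : realType) (Omega : boundedDomain R) : Type := MkRO {
  RO_fun :> closure Omega -> R[i]^o;
  RO_mem : RO_fun \in RO_pred Omega }.

HB.instance Definition _ (R : realType) (Omega : boundedDomain R) :=
  [isSub of RO Omega for @RO_fun R Omega].
HB.instance Definition _ (R : realType) (Omega : boundedDomain R) :=
  [Choice of RO Omega by <:].

Definition sup_norm (R : realType) (Omega : boundedDomain R) (f : RO Omega) : R :=
  sup [set Normc.normc (f z) | z in [set: closure Omega]].

Section RO_normed_space.
Context (R : realType) (Omega : boundedDomain R).
Local Notation C := (R[i]^o).
Implicit Types (K : set C).

Lemma normr_normc (z : C) : `|z| = (Normc.normc z)%:C.
Proof. by []. Qed.

Lemma normc_ge0 (z : C) : 0 <= Normc.normc z.
Proof. by rewrite -lecR -normr_normc normr_ge0. Qed.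

Lemma uniform_cvgP K (r : nat -> K -> C) (f : K -> C) :
  {uniform, r @ \oo --> f} <->
  (forall e : R[i], 0 < e -> \forall n \near \oo, forall z, `|f z - r n z| < e).
Proof.
split=> [rf e e0|rf].
  apply: (rf [set h | forall z, `|f z - h z| < e]).
  apply/uniform_nbhs; exists [set xy : C * C | `|xy.1 - xy.2| < e]; split.
    by rewrite -entourage_ballE; exists e.
  by move=> h hP z; apply: hP.
move=> P /uniform_nbhs[E [entE EP]].
move: entE; rewrite -entourage_ballE => -[e /= e0 eE].
have := rf e e0; apply: filterS => n rn; apply: EP => z _.
by apply: eE; exact: rn.
Qed.

Lemma rational_off_polesZD K (a : R[i]) (r s : K -> C) :
  rational_off_poles r -> rational_off_poles s ->
  rational_off_poles (a *: r + s).
Proof.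
move=> [p [q [q0 rE]]] [p' [q' [q'0 sE]]].
exists (a *: p * q' + p' * q), (q * q'); split=> z.
  by rewrite hornerM mulf_neq0.
have -> : (a *: r + s) z = a * r z + s z by [].
rewrite rE sE mulrA addf_div.
- by rewrite !hornerE.
- exact: q0.
- exact: q'0.
Qed.

Lemma RO_submod_closed : submod_closed (RO_pred Omega).
Proof.
split=> [|a f g /asboolP[r [rr rf]] /asboolP[s [rs sg]]].
  apply/asboolP; exists (fun=> 0); split.
    move=> _; exists 0, 1; split=> z; first by rewrite hornerC oner_neq0.
    by rewrite horner0 mul0r.
  apply/uniform_cvgP => e e0; exists 0%N => // n _ z.
  by rewrite subrr normr0.
apply/asboolP; exists (fun n => a *: r n + s n); split.
  by move=> n; exact: rational_off_polesZD.
move/uniform_cvgP in rf; move/uniform_cvgP in sg.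
apply/uniform_cvgP => e e0.
have a0 : 0 < `|a| + 1 by rewrite ltr_wpDl.
have e1 : 0 < e / 2 / (`|a| + 1) by rewrite !divr_gt0.
have e2 : 0 < e / 2 by rewrite divr_gt0.
apply: filterS2 (rf _ e1) (sg _ e2) => n frn gsn z.
have -> : (a *: f + g) z - (a *: r n + s n) z =
          a * (f z - r n z) + (g z - s n z).
  have -> : (a *: f + g) z = a * f z + g z by [].
  have -> : (a *: r n + s n) z = a * r n z + s n z by [].
  by rewrite mulrBr opprD addrACA.
rewrite (splitr e) (le_lt_trans (ler_normD _ _))// ler_ltD//.
rewrite normrM (@le_trans _ _ ((`|a| + 1) * `|f z - r n z|))//.
  by rewrite ler_wpM2r// lerDl.
by rewrite mulrC -ler_pdivlMr// ltW.
Qed.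

HB.instance Definition _ :=
  GRing.isSubmodClosed.Build R[i] (closure Omega -> C) (RO_pred Omega)
    RO_submod_closed.
HB.instance Definition _ := [SubChoice_isSubLmodule of RO Omega by <:].

Lemma closure_domain_bounded :
  exists M : R[i], forall z, closure Omega z -> `|z| <= M.
Proof.
have [M M0 OM] := pinfty_ex_gt0 (domain_bounded Omega).
exists (1 + M) => z cz.
have [y [Oy zy]] := cz _ (nbhsx_ballx z 1 ltr01).
rewrite -[z](subrK y) (le_trans (ler_normD _ _))// lerD//.
  by move: zy; rewrite -ball_normE /= => /ltW.
exact: OM.
Qed.

Lemma poly_bounded (p : {poly R[i]}) :
  exists M : R[i], forall z, closure Omega z -> `|p.[z]| <= M.
Proof.
have [B OB] := closure_domain_bounded.
elim/poly_ind: p => [|p c [M pM]].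
  by exists 0 => z _; rewrite horner0 normr0.
exists (M * B + `|c|) => z Oz.
rewrite !hornerE (le_trans (ler_normD _ _))// lerD// normrM ler_pM//.
  exact: pM.
exact: OB.
Qed.

Lemma poly_bounded_below (q : {poly R[i]}) :
  (forall z, closure Omega z -> q.[z] != 0) ->
  exists2 d : R[i], 0 < d & forall z, closure Omega z -> d <= `|q.[z]|.
Proof.
have [rs ->] := closed_field_poly_normal q.
set c := lead_coef q => q0.
have [w Ow] := domain_neq0 Omega.
have c0 : c != 0.
  have := q0 w (subset_closure Ow).
  by apply: contraNneq => ->; rewrite scale0r horner0.
have {}q0 a : a \in rs -> ~ closure Omega a.
  move=> ars /q0; rewrite hornerZ mulf_eq0 negb_or.
  by move=> /andP[_]; rewrite -rootE root_prod_XsubC ars.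
suff [d d0 dP] : exists2 d : R[i], 0 < d & forall z, closure Omega z ->
    d <= `|(\prod_(a <- rs) ('X - a%:P)).[z]|.
  exists (`|c| * d); first by rewrite mulr_gt0// normr_gt0.
  by move=> z Oz; rewrite hornerZ normrM ler_wpM2l// dP.
elim: rs q0 => [|a rs IH] q0.
  by exists 1 => // z _; rewrite big_nil hornerC normr1.
have [b brs|d d0 dP] := IH; first by apply: q0; rewrite in_cons brs orbT.
have : open (~` closure Omega) by rewrite openC; exact: closed_closure.
rewrite openE => /(_ a (q0 a (mem_head _ _))) /nbhs_ballP[e /= e0 eP].
exists (e * d); first by rewrite mulr_gt0.
move=> z Oz; rewrite big_cons hornerM normrM ler_pM ?(ltW e0) ?(ltW d0) ?dP//.
rewrite hornerXsubC real_leNgt ?(gtr0_real e0) ?normr_real//; apply/negP => zae.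
by apply: (eP z) => //; rewrite -ball_normE /= distrC.
Qed.

Lemma RO_bounded (f : RO Omega) : exists M : R, forall z, Normc.normc (f z) <= M.
Proof.
suff [M fM] : exists M : R[i], forall z, `|f z| <= M.
  by exists (complex.Re M) => z; have := fM z; rewrite normr_normc lecE => /andP[].
have /asboolP[r [rr /uniform_cvgP/(_ 1 ltr01)[n _ /(_ n (leqnn n)) fr]]] := RO_mem f.
have [p [q [q0 rE]]] := rr n.
have [M pM] := poly_bounded p.
have [|d d0 dP] := @poly_bounded_below q.
  by move=> z Oz; exact: (q0 (exist _ z (mem_set Oz))).
exists (1 + M / d) => z.
have Oz : closure Omega (\val z) by exact: set_valP.
rewrite -[f z](subrK (r n z)) (le_trans (ler_normD _ _))// lerD//.
  exact/ltW/fr.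
rewrite rE normrM normfV ler_pM ?invr_ge0//; first exact: pM.
by rewrite lef_pV2 ?dP// posrE ?normr_gt0.
Qed.

Lemma le_sup_norm (f : RO Omega) z : Normc.normc (f z) <= sup_norm f.
Proof.
have [M fM] := RO_bounded f.
by apply: ub_le_sup; [exists M => _ [w _ <-]|exists z].
Qed.

Lemma sup_norm_le (f : RO Omega) (M : R) :
  (forall z, Normc.normc (f z) <= M) -> sup_norm f <= M.
Proof.
move=> fM; apply: ge_sup => [|_ [z _ <-]//].
have [w Ow] := domain_neq0 Omega.
by exists (Normc.normc (f (exist _ w (mem_set (subset_closure Ow))))),
   (exist _ w (mem_set (subset_closure Ow))).
Qed.

Lemma sup_norm_triangle (f g : RO Omega) :
  (sup_norm (f + g))%:C <= (sup_norm f)%:C + (sup_norm g)%:C.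
Proof.
rewrite -rmorphD lecR; apply: sup_norm_le => z.
apply: (le_trans (le_normcD _ _)); apply: lerD; exact: le_sup_norm.
Qed.

Lemma sup_normZ (a : R[i]) (f : RO Omega) :
  (sup_norm (a *: f))%:C = `|a| * (sup_norm f)%:C.
Proof.
rewrite normr_normc -rmorphM; congr (_%:C); apply/eqP; rewrite eq_le; apply/andP; split.
  apply: sup_norm_le => z.
  have -> : (a *: f) z = a * f z by [].
  by rewrite Normc.normcM ler_wpM2l ?le_sup_norm// normc_ge0.
have [->|a0] := eqVneq a 0.
  have -> : Normc.normc (0 : R[i]) * sup_norm f = 0.
    by rewrite Normc.normc0; exact: mul0r.
  have [w Ow] := domain_neq0 Omega.
  apply: le_trans (le_sup_norm _ (exist _ w (mem_set (subset_closure Ow)))).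
  exact: normc_ge0.
have na0 : 0 < Normc.normc a by rewrite -ltcR -normr_normc normr_gt0.
rewrite mulrC -ler_pdivlMr//; apply: sup_norm_le => z.
rewrite ler_pdivlMr// mulrC -Normc.normcM.
exact: (le_sup_norm (a *: f) z).
Qed.

Lemma sup_norm_eq0 (f : RO Omega) : (sup_norm f)%:C = 0 -> f = 0.
Proof.
move=> /complexI f0; apply/val_inj/funext => z.
apply: Normc.eq0_normc; apply/eqP; rewrite eq_le -{1}f0.
apply/andP; split; first exact: le_sup_norm.
exact: normc_ge0.
Qed.

HB.instance Definition _ := Lmodule_isNormed.Build R[i] (RO Omega)
  sup_norm_triangle sup_normZ sup_norm_eq0.

Lemma RO_normE (f : RO Omega) : `|f| = (sup_norm f)%:C.
Proof. by []. Qed.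

End RO_normed_space.

(* The limit superior is taken over z in the topological space [closure Omega],
   z tending to z0 within J \ {z0}. *)
Definition S_set (R : realType) (Omega : boundedDomain R) (J : set R[i]^o) :
    set (RO Omega) :=
  [set f | forall z0 : closure Omega, J (\val z0) ->
    limf_esup
      (fun z : closure Omega =>
        (Normc.normc ((f z - f z0) / (\val z - \val z0)))%:E)
      (within [set z : closure Omega | (J `\ \val z0) (\val z)] (nbhs z0))
    = +oo%E].
Arguments S_set {R} Omega J _.

(* Main.v *)
Require Import Defs.
From mathcomp Require Import all_boot all_order all_algebra.
From mathcomp Require Import all_classical all_reals all_analysis.
From mathcomp Require Import borel_hierarchy complex.
From mathcomp Require Import ring lra.
Set Implicit Arguments.
Unset Strict Implicit.
Unset Printing Implicit Defensive.
Import numFieldNormedType.Exports.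
Import Order.TTheory GRing.Theory Num.Theory.
Local Open Scope classical_set_scope.
Local Open Scope ring_scope.

(** The set of functions with infinite upper difference quotient at every
point of [J] is handled by two independent observations, neither of which
uses the Baire category theorem.

G_delta. The upper difference quotient of [f] at [z0] is infinite exactly when
for every [n] some [z] in [J] with |z0 - z| < 1/(n+1) satisfies
n |z0 - z| < |f z0 - f z|. Asking this at all points of [J] for a fixed [n]
gives [steep_set n], and the intersection over [n] is the set in question
([S_set_steepE]). Each [steep_set n] is open ([steep_set_open]): at one point
[y] of [J] the two inequalities are strict, so the same [z] serves all points
near [y] and all functions near [f], because [f] is uniformly continuous; the
compactness of [J] then makes the neighbourhood of [f] independent of [y].

Density. A rational function [r] with poles off the closure of the domain is
Lipschitz there ([rational_lipschitz]), so its difference quotients are bounded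
and adding it to a nonzero multiple of [f] leaves the upper difference
quotients of [f] infinite ([S_set_lipschitz_perturbation]). Hence one member
[f] yields the members [t f + r], with [t] small and [r] rational, and these
are dense because the rational functions are ([S_set_dense]). The Lipschitz
bound also gives the uniform continuity used above: a uniform limit of
Lipschitz functions is uniformly continuous. *)

Local Notation modulus := (@Normc.normc _).

(** * The modulus as a real-valued metric *)

Section Modulus.
Context (R : realType).
Implicit Types (x y z : R[i]) (e : R).

Lemma modulusN x : modulus (- x) = modulus x.
Proof. exact: normcN. Qed.

Lemma modulus_gt0 x : (0 < modulus x) = (x != 0).
Proof. by rewrite -ltcR -(normr_normc x) normr_gt0. Qed.

Lemma modulus_distC x y : modulus (x - y) = modulus (y - x).
Proof. by rewrite -modulusN opprB. Qed.

Lemma modulusD x y : modulus (x + y) <= modulus x + modulus y.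
Proof. exact: le_normcD. Qed.

Lemma modulus_triangle y x z :
  modulus (x - z) <= modulus (x - y) + modulus (y - z).
Proof.
have -> : x - z = (x - y) + (y - z) by rewrite addrA subrK.
exact: modulusD.
Qed.

(** The order of [R[i]] only compares numbers with equal imaginary parts, so a
positive complex radius is a real one. *)
Lemma posc_real (e : R[i]) : 0 < e -> exists2 d : R, 0 < d & e = d%:C%C.
Proof. by case: e => a b; rewrite ltcE /= => /andP[/eqP -> a0]; exists a. Qed.

Lemma nbhs_modulusP (x : R[i]^o) (A : set R[i]^o) :
  nbhs x A <-> exists2 e : R, 0 < e & forall y, modulus (x - y) < e -> A y.
Proof.
split=> [/nbhs_ballP[_ /posc_real[d d0 ->] dA]|[e e0 eA]].
  exists d => // y xy; apply: dA; rewrite -ball_normE /=.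
  by rewrite normr_normc ltcR.
apply/nbhs_ballP; exists (e%:C%C); first by rewrite /= ltcR.
by move=> y; rewrite -ball_normE /= normr_normc ltcR => /eA.
Qed.

End Modulus.

(** * Rational functions and their uniform limits *)

Section RO_facts.
Context (R : realType) (Omega : boundedDomain R).
Implicit Types (f g r : RO Omega) (z w : closure Omega).

Lemma closure_val z : closure Omega (\val z).
Proof. exact: set_valP. Qed.
(* [closure] unfolds to a product, whose binders would otherwise be counted as
   implicit arguments. *)
Arguments closure_val : clear implicits.

Lemma nbhs_closureP z (A : set (closure Omega)) :
  nbhs z A <->
  exists2 e : R, 0 < e & forall w, modulus (\val z - \val w) < e -> A w.
Proof.
split.
  rewrite nbhsE => -[_ [[B oB <-] Bz] BA].
  have /nbhs_modulusP[e e0 eB] : nbhs (\val z : R[i]^o) B.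
    exact: (open_nbhs_nbhs (conj oB Bz)).
  by exists e => // w /eB Bw; apply: BA.
move=> [e e0 eA].
have zB : nbhs (\val z : R[i]^o) [set y | modulus (\val z - y) < e].
  by apply/nbhs_modulusP; exists e.
have := @initial_continuous _ _ (set_val : closure Omega -> R[i]^o) z _ zB.
exact: filterS (fun w => eA w).
Qed.

Lemma nbhs_ROP f (A : set (RO Omega)) :
  nbhs f A <-> exists2 e : R, 0 < e & forall g, sup_norm (f - g) < e -> A g.
Proof.
split=> [/nbhs_ballP[_ /posc_real[d d0 ->] dA]|[e e0 eA]].
  exists d => // g fg; apply: dA; rewrite -ball_normE /=.
  by rewrite RO_normE ltcR.
apply/nbhs_ballP; exists (e%:C%C); first by rewrite /= ltcR.
by move=> g; rewrite -ball_normE /= RO_normE ltcR => /eA.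
Qed.

Lemma sup_normD f g : sup_norm (f + g) <= sup_norm f + sup_norm g.
Proof. by have := sup_norm_triangle f g; rewrite -rmorphD lecR. Qed.

Lemma modulus_dist_le f g z : modulus (f z - g z) <= sup_norm (f - g).
Proof. exact: (le_sup_norm (f - g)). Qed.

Definition lipschitz_with (L : R) (f : closure Omega -> R[i]^o) :=
  forall z w, modulus (f z - f w) <= L * modulus (\val z - \val w).

Lemma poly_modulus_bounded (p : {poly R[i]}) :
  exists M : R, forall z, modulus p.[\val z] <= M.
Proof.
have [M pM] := @poly_bounded _ Omega p.
exists (complex.Re M) => z; have := pM _ (closure_val z).
by rewrite normr_normc lecE => /andP[].
Qed.

(** By induction on the degree. A bound on the derivative would not suffice, as
[closure Omega] need not be convex; the product rule for differences works on
any bounded set. *)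
Lemma poly_lipschitz (p : {poly R[i]}) :
  exists L, lipschitz_with L (fun z => p.[\val z]).
Proof.
elim/poly_ind: p => [|p c [L pL]].
  by exists 0 => z w; rewrite !horner0 subrr Normc.normc0 mul0r.
have [M pM] := poly_modulus_bounded p.
have [B XB] := poly_modulus_bounded 'X.
exists (M + B * L) => z w.
have -> : (p * 'X + c%:P).[\val z] - (p * 'X + c%:P).[\val w] =
    p.[\val z] * (\val z - \val w) + \val w * (p.[\val z] - p.[\val w]).
  by rewrite !hornerE; ring.
rewrite (le_trans (modulusD _ _))// !Normc.normcM mulrDl lerD//.
  by rewrite ler_wpM2r ?normc_ge0.
rewrite -mulrA ler_pM ?normc_ge0//.
by have := XB w; rewrite hornerX.
Qed.

(** The denominator is bounded away from zero because its finitely many zeros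
lie outside the closed set [closure Omega]. *)
Lemma rational_lipschitz (r : closure Omega -> R[i]^o) :
  rational_off_poles r -> exists L, lipschitz_with L r.
Proof.
move=> [p [q [q0 rE]]].
have [Lp pL] := poly_lipschitz p; have [Lq qL] := poly_lipschitz q.
have [M pM] := poly_modulus_bounded p.
have [|_ /posc_real[d d0 ->] dq] := @poly_bounded_below R Omega q.
  by move=> z Oz; exact: (q0 (exist _ z (mem_set Oz))).
have {}dq z : modulus q.[\val z]^-1 <= d^-1.
  have qz : d <= modulus q.[\val z].
    by have := dq _ (closure_val z); rewrite normr_normc lecR.
  by rewrite Normc.normcV lef_pV2 // posrE (lt_le_trans d0).
exists (Lp / d + M * (Lq / d / d)) => z w.
have -> : r z - r w = (p.[\val z] - p.[\val w]) * q.[\val z]^-1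
    + p.[\val w] * ((q.[\val w] - q.[\val z]) * q.[\val z]^-1 * q.[\val w]^-1).
  by rewrite !rE; field; rewrite !q0.
rewrite (le_trans (modulusD _ _))// !Normc.normcM mulrDl lerD//.
  rewrite mulrAC ler_pM ?normc_ge0 //; exact: pL.
have -> : M * (Lq / d / d) * modulus (\val z - \val w) =
    M * (Lq * modulus (\val z - \val w) / d / d) by ring.
rewrite ler_pM ?mulr_ge0 ?normc_ge0// ler_pM ?mulr_ge0 ?normc_ge0//.
rewrite ler_pM ?normc_ge0//.
by rewrite modulus_distC; exact: qL.
Qed.

Lemma rational_uniform_rational_limit (K : set R[i]^o) (r : K -> R[i]^o) :
  rational_off_poles r -> uniform_rational_limit r.
Proof.
move=> rr; exists (fun=> r); split=> //; apply/uniform_cvgP => e e0.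
by exists 0%N => // n _ z; rewrite subrr normr0.
Qed.

Lemma rational_dense f (e : R) : 0 < e ->
  exists r, rational_off_poles r /\ sup_norm (f - r) <= e.
Proof.
move=> e0; have /asboolP[r [rr /uniform_cvgP rf]] := RO_mem f.
have [|n _ /(_ n (leqnn n)) fr] := rf e%:C%C; first by rewrite ltcR.
exists (MkRO (asboolT (rational_uniform_rational_limit (rr n)))).
split; first exact: rr.
by apply: sup_norm_le => z; have := fr z; rewrite normr_normc ltcR => /ltW.
Qed.

(** An approximation of [f] by a rational function within [e / 4] costs [e / 2]
at the two points, and the Lipschitz bound of that function controls the rest. *)
Lemma RO_uniform_continuous f (e : R) : 0 < e ->
  exists2 d : R, 0 < d &
    forall z w, modulus (\val z - \val w) < d -> modulus (f z - f w) < e.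
Proof.
move=> e0; have [|r [/rational_lipschitz[L rL] fr]] := rational_dense f (e := e / 4).
  by lra.
have L0 : 0 < `|L| + 1 by rewrite ltr_wpDl.
(* [L] may be zero or negative, hence the shift. *)
exists (e / 4 / (`|L| + 1)); first by rewrite !divr_gt0.
move=> z w; rewrite ltr_pdivlMr// => zw.
have := modulus_triangle (r z) (f z) (f w).
have := modulus_triangle (r w) (r z) (f w).
have := modulus_dist_le f r z; have := modulus_dist_le f r w.
rewrite (modulus_distC (f w)) => fw fz.
have := rL z w; have := normc_ge0 (\val z - \val w); have := ler_norm L.
nra.
Qed.

End RO_facts.

(** * Infinite upper difference quotients *)

Section Steep.
Context (R : realType) (Omega : boundedDomain R) (J : set R[i]^o).
Implicit Types (f g r : RO Omega) (z w : closure Omega).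

(** One index [n] serves both as a scale and as a slope. The second inequality
is cleared of denominators; being strict, it forces [z] to differ from [z0]. *)
Definition steep_at (n : nat) f z0 : Prop :=
  exists z, [/\ J (\val z), modulus (\val z0 - \val z) < n.+1%:R^-1 &
    n%:R * modulus (\val z0 - \val z) < modulus (f z0 - f z)].

Definition steep_set (n : nat) : set (RO Omega) :=
  [set f | forall z0, J (\val z0) -> steep_at n f z0].

(** The limit superior is an infimum of suprema, so it is infinite exactly when
all the suprema over punctured neighbourhoods are. *)
Lemma S_set_steepE : S_set Omega J = \bigcap_n steep_set n.
Proof.
apply/seteqP; split=> f Sf.
  move=> n _ z0 Jz0.
  have /ereal_inf_pinfty Sz0 := Sf z0 Jz0.
  pose V : set (closure Omega) :=
    [set z | (J `\ \val z0) (\val z) /\ modulus (\val z0 - \val z) < n.+1%:R^-1].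
  pose q (z : closure Omega) := (modulus ((f z - f z0) / (\val z - \val z0)))%:E.
  have supV : ereal_sup (q @` V) = +oo%E.
    apply: Sz0; exists V => //; apply/nbhs_closureP.
    by exists n.+1%:R^-1; [rewrite invr_gt0|move=> w zw Jw; split].
  have : (n%:R%:E < ereal_sup (q @` V))%E by rewrite supV ltry.
  move/ereal_sup_gt => [_ [z [[Jz zz0] zV] <-]]; rewrite /q lte_fin => nq.
  exists z; split=> //.
  have zz0' : 0 < modulus (\val z0 - \val z).
    by rewrite modulus_gt0 subr_eq0; apply/eqP => e; apply: zz0.
  move: nq; rewrite Normc.normcM Normc.normcV (modulus_distC (\val z)).
  by rewrite ltr_pdivlMr// (modulus_distC (f z)).
move=> z0 Jz0; apply/ereal_inf_pinfty => _ [V /nbhs_closureP[e e0 eV] <-] /=.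
apply/eqyP => A A0.
(* Large enough for the slope [A] and for the radius [e] at once. *)
pose n := maxn (Num.truncn A).+1 (Num.truncn e^-1).+1.
have [z [Jz zz0 fz]] := Sf n I z0 Jz0.
have nA : A <= n%:R.
  by rewrite (le_trans (ltW (truncnS_gt A)))// ler_nat leq_maxl.
have ne : n.+1%:R^-1 <= e.
  rewrite -[leRHS]invrK lef_pV2 ?posrE ?invr_gt0//.
  by rewrite (le_trans (ltW (truncnS_gt _)))// ler_nat ltnW// ltnS leq_maxr.
have d0 : 0 < modulus (\val z0 - \val z).
  rewrite modulus_gt0 subr_eq0; apply: contraTneq fz => /val_inj ->.
  by rewrite !subrr Normc.normc0 mulr0 ltxx.
apply: (@le_trans _ _ (modulus ((f z - f z0) / (\val z - \val z0)))%:E).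
  rewrite lee_fin Normc.normcM Normc.normcV (modulus_distC (\val z)).
  rewrite (modulus_distC (f z)) ler_pdivlMr// (le_trans _ (ltW fz))//.
  by rewrite ler_pM2r.
apply: ereal_sup_ubound; exists z => //; apply: eV.
  exact: lt_le_trans ne.
by split=> // e'; move: d0; rewrite e' subrr Normc.normc0 ltxx.
Qed.

(** The compactness of [J] enters as the near-covering property: what holds
jointly for all functions near [f] and all points near each point of [J] holds
on the whole of [J] for all functions near [f]. *)
Lemma steep_set_open n : compact J -> open (steep_set n).
Proof.
move=> /compact_near_coveringP cJ; rewrite openE => f fn.
(* [J] is compact in the plane, whereas [steep_at] takes points of the subtype
   [closure Omega]. *)
pose P g (y : R[i]^o) := forall z0, \val z0 = y -> steep_at n g z0.
suff : \forall g \near f, J `<=` P g.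
  by apply: filterS => g JP z0 Jz0; exact: (JP _ Jz0).
apply: (cJ _ (nbhs f) P) => y Jy.
(* Away from [closure Omega], [P] holds vacuously on a neighbourhood. *)
have [Oy|Oy] := pselect (closure Omega y); last first.
  have : nbhs y (~` closure Omega).
    by apply: open_nbhs_nbhs; split=> //; rewrite openC; exact: closed_closure.
  move=> yO; exists (~` closure Omega, setT) => /=.
    by split=> //; exact: filterT.
  by move=> [x g] [/= Ox _] z0 z0x; case: Ox; rewrite -z0x; exact: closure_val.
pose y' : closure Omega := exist _ y (mem_set Oy).
have [z [Jz yz fz]] : exists z, [/\ J (\val z),
    modulus (y - \val z) < n.+1%:R^-1 &
    n%:R * modulus (y - \val z) < modulus (f y' - f z)] by exact: (fn y' Jy).
(* The slack [e] is shared equally by the change of [f] between [y] and [x], by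
   the replacement of [f] by [g] at [x] and at [z], and by the term
   [n |y - x|]; dividing by [n.+1] covers [n = 0]. *)
pose e := modulus (f y' - f z) - n%:R * modulus (y - \val z).
have e0 : 0 < e by rewrite subr_gt0.
have [|d1 d10 fd1] := @RO_uniform_continuous _ _ f (e / 4); first by lra.
pose d2 := n.+1%:R^-1 - modulus (y - \val z).
have d20 : 0 < d2 by rewrite subr_gt0.
pose d3 := e / 4 / n.+1%:R.
have d30 : 0 < d3 by rewrite !divr_gt0.
pose d := Num.min d1 (Num.min d2 d3).
have d0 : 0 < d by rewrite !lt_min d10 d20.
exists ([set x | modulus (y - x) < d], [set g | sup_norm (f - g) < e / 4]) => /=.
  split; first by apply/nbhs_modulusP; exists d.
  by apply/nbhs_ROP; exists (e / 4) => //; lra.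
move=> [u g] [/= + fg] x xu; rewrite -{}xu => yx; exists z.
move: yx; rewrite !lt_min => /and3P[/(fd1 y' x) fx xd2].
rewrite ltr_pdivlMr// => xd3.
have xz := modulus_triangle y (\val x) (\val z).
rewrite (modulus_distC (\val x) y) in xz.
split=> //; first by rewrite (le_lt_trans xz)// -ltrBrDr.
have := modulus_dist_le f g x; have := modulus_dist_le f g z.
have := modulus_triangle (f x) (f y') (f z).
have := modulus_triangle (g x) (f x) (f z).
have := modulus_triangle (g z) (g x) (f z).
rewrite (modulus_distC (g z) (f z)).
have n0 : 0 <= n%:R :> R by [].
move: xd3; rewrite -natr1; have := normc_ge0 (y - \val x).
move: fg fx xz; rewrite /e /=.
nra.
Qed.

(** A Lipschitz term changes slopes by at most [L], which is absorbed by asking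
[f] for the slope [(n + L) / |a|] instead of [n]. *)
Lemma S_set_lipschitz_perturbation f r (a : R[i]) (L : R) :
  S_set Omega J f -> lipschitz_with L r -> a != 0 -> S_set Omega J (a *: f + r).
Proof.
rewrite S_set_steepE => Sf rL a0 n _ z0 Jz0.
have {}a0 : 0 < modulus a by rewrite modulus_gt0.
pose m := maxn n (Num.truncn ((n%:R + L) / modulus a)).+1.
have [z [Jz zz0 fz]] := Sf m I z0 Jz0.
exists z; split=> //.
  by rewrite (lt_le_trans zz0)// lef_pV2 ?posrE// ler_nat ltnS leq_maxl.
have mL : n%:R + L <= m%:R * modulus a.
  rewrite -ler_pdivrMr// (le_trans (ltW (truncnS_gt _)))//.
  by rewrite ler_nat leq_maxr.
have hz w : (a *: f + r) w = a * f w + r w by [].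
have := modulusD ((a *: f + r) z0 - (a *: f + r) z) (r z - r z0).
have -> : (a *: f + r) z0 - (a *: f + r) z + (r z - r z0) = a * (f z0 - f z).
  by rewrite !hz; ring.
rewrite Normc.normcM (modulus_distC (r z)).
have := rL z0 z; have := normc_ge0 (\val z0 - \val z).
move: fz; rewrite -(ltr_pM2l a0) => fz; nra.
Qed.

(** Approximants of [g] are sought in the form [t f + r], with [r] rational close
to [g] and [t > 0] small enough for [t f] to be negligible. *)
Lemma S_set_dense : S_set Omega J !=set0 -> dense (S_set Omega J).
Proof.
move=> [f Sf] O [g Og] oO.
have /nbhs_ROP[e e0 eO] : nbhs g O by exact: open_nbhs_nbhs.
have [|r [/rational_lipschitz[L rL] gr]] := rational_dense g (e := e / 2).
  by lra.
have M0 : 0 <= sup_norm f by rewrite -lecR -RO_normE normr_ge0.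
pose t := e / 2 / (sup_norm f + 1).
have t0 : 0 < t by rewrite !divr_gt0// ltr_wpDl.
exists (t%:C%C *: f + r); split; last first.
  by apply: S_set_lipschitz_perturbation rL _ => //; rewrite gt_eqF// ltcR.
apply: eO.
have -> : g - (t%:C%C *: f + r) = (g - r) + (- t%:C%C) *: f.
  by rewrite scaleNr opprD addrCA addrC.
rewrite (le_lt_trans (sup_normD _ _))//.
have -> : sup_norm ((- t%:C%C) *: f) = t * sup_norm f.
  have nt : `|t%:C%C| = t%:C%C :> R[i] by rewrite ger0_norm// lecR ltW.
  by apply: complexI; rewrite sup_normZ normrN nt [RHS]rmorphM.
have : t * (sup_norm f + 1) = e / 2 by rewrite divfK// gt_eqF// ltr_wpDl.
nra.
Qed.

End Steep.

Theorem theorem2p1 (R : realType) (Omega : boundedDomain R) (J : set R[i]^o)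
    (J_boundary : J `<=` boundary Omega)
    (J_compact : compact J)
    (J_no_isolated : isolated J = set0) :
  S_set Omega J = set0 \/ (dense (S_set Omega J) /\ Gdelta (S_set Omega J)).
Proof.
have [S0|/set0P/S_set_dense Sd] := eqVneq (S_set Omega J) set0; [by left|right].
split=> //; exists (@steep_set R Omega J); last exact: S_set_steepE.
by move=> n; exact: steep_set_open.
Qed.
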